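(* Let $n\ge 2$ and let $\mu_1,\ldots,\mu_n$ be atomless probability measures on the real line. Define $$s=\sup\Bigl\{x:\ \sum_{i=1}^n\mu_i\bigl((-\infty,x]\bigr)\le 1\Bigr\}.$$ Then a measure $\pi\in\Pi(\mu_1,\ldots,\mu_n)$ solves the Monge--Kantorovich problem with marginals $\mu_1,\ldots,\mu_n$ and the cost function $c(x_1,\ldots,x_n)=\min(x_1,\ldots,x_n)$ if and only if every point $x=(x_1,\ldots,x_n)\in\operatorname{supp}(\pi)\subset\mathbb{R}^n$ satisfies the following conditions (for every $i\in\{1,\ldots,n\}$): 1) if $x_i\le s$, then $x_j\ge s$ for every $j\neq i$; 2) if $x_i\ge s$, then there exists $j\neq i$ such that $x_j\le s$.
   Context: $\Pi(\mu_1,\ldots,\mu_n)$ denotes the set of Borel probability measures on $\mathbb{R}^n$ whose $i$-th one-dimensional marginal is $\mu_i$ for each $i$. A measure $\pi\in\Pi(\mu_1,\ldots,\mu_n)$ solves the Monge--Kantorovich problem with cost $c$ if it minimizes $\pi\mapsto\int c\,d\pi$ over $\Pi(\mu_1,\ldots,\mu_n)$. $\operatorname{supp}(\pi)$ is the support of $\pi$.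
   Formalization: The premises of 1) and 2) are strict (x_i < s, x_i > s), since ''only if'' fails with ≤, ≥ (e.g. two uniform marginals on [0,1], s = 1/2, support point (0,1/2)); the negative part of each marginal is assumed to have finite integral, so that the cost is well defined. *)

(* Defs.v *)
From HB Require Import structures.
From mathcomp Require Import all_boot all_order all_algebra.
From mathcomp Require Import all_classical all_reals all_analysis.

Set Implicit Arguments.
Unset Strict Implicit.
Unset Printing Implicit Defensive.

Import Order.TTheory GRing.Theory Num.Theory.
Import numFieldNormedType.Exports.

Local Open Scope classical_set_scope.
Local Open Scope ring_scope.

Definition borelRn (R : realType) (n : nat) :=
  g_sigma_algebraType (@open 'rV[R]_n).

Definition coordinate (R : realType) (n : nat) (i : 'I_n)
  (x : borelRn R n) : R := (x : 'rV[R]_n) ord0 i.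

Definition coupling (R : realType) (n : nat)
    (mu : 'I_n -> probability (measurableTypeR R) R)
    (pi : probability (borelRn R n) R) : Prop :=
  forall (i : 'I_n) (A : set (measurableTypeR R)), measurable A ->
    pi (coordinate i @^-1` A) = mu i A.

(* The integral of an arbitrary extended-real function f is
   \int f^\+ - \int f^\-, so this is meaningful when one of the two terms is
   finite; oo - oo would be -oo. *)
Definition solves_MK (R : realType) (n : nat)
    (mu : 'I_n -> probability (measurableTypeR R) R)
    (c : borelRn R n -> \bar R) (pi : probability (borelRn R n) R) : Prop :=
  coupling mu pi /\
  forall pi' : probability (borelRn R n) R, coupling mu pi' ->
    (\int[pi]_x c x <= \int[pi']_x c x)%E.

(* On a real line, a Borel probability measure has no atom if and only if it
   has no point of positive mass. *)
Definition atomless (R : realType) (mu : probability (measurableTypeR R) R) :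
  Prop := forall x : R, mu [set x] = 0%E.

Definition measure_supp (R : realType) (n : nat)
    (pi : probability (borelRn R n) R) : set 'rV[R]_n :=
  [set x | forall U : set 'rV[R]_n, open U -> U x -> (0 < pi U)%E].

(* The unit +oo only matters for n = 0. *)
Definition min_cost (R : realType) (n : nat) (x : borelRn R n) : \bar R :=
  \big[Order.min/+oo%E]_(i < n) (coordinate i x)%:E.

Definition threshold (R : realType) (n : nat)
    (mu : 'I_n -> probability (measurableTypeR R) R) : R :=
  sup [set x : R | (\sum_(i < n) mu i `]-oo, x]%classic <= 1)%E].

(* This makes the value of the problem with cost min_cost well defined:
   min_cost^\- is the maximum of the negative parts of the coordinates, so
   its integral is finite for one (equivalently, every) coupling if and only
   if all marginals have this property. *)
Definition integrable_neg_part (R : realType)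
    (mu : probability (measurableTypeR R) R) : Prop :=
  (\int[mu]_x (Num.max (- (x : R)) 0)%:E < +oo)%E.

(* Main.v *)
Require Import Defs.
From HB Require Import structures.
From mathcomp Require Import all_boot all_order all_algebra.
From mathcomp Require Import all_classical all_reals all_analysis.
From mathcomp Require Import measurable_realfun.
From mathcomp Require Import ring lra.
Import Order.TTheory GRing.Theory Num.Theory.
Import numFieldNormedType.Exports.
Local Open Scope classical_set_scope.
Local Open Scope ring_scope.

(* For every point x, min x >= s - sum_i (s - x_i)^+, with equality exactly
   when at most one coordinate is < s and not all coordinates are > s. The
   integral of the right-hand side is the same finite number for all couplings,
   so a coupling for which the gap between the two sides has integral 0 is
   optimal, and every optimal coupling has this property as soon as one coupling
   does. The set of points where the gap is positive is open, hence is null if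
   and only if it does not meet the support.

   A coupling with zero gap: the atomless marginals have F_1(s) + ... + F_n(s)
   = 1, which cuts ]0, 1] into consecutive intervals of lengths F_i(s). For U
   uniform on [0, 1], let the i-th coordinate be the quantile function of mu_i
   at U rotated so that the i-th interval becomes ]0, F_i(s)]. The i-th
   coordinate has law mu_i; it is <= s when U lies in the i-th interval and
   >= s otherwise, and exactly one interval contains U. *)

(** * Borel sets and supports in ['rV[R]_n] *)

(** A countable base of the topology: rational centres and radii [k.+1%:R^-1], coded by natural
    numbers; numbers that code nothing give the empty set. *)
Definition rational_ball {R : realType} {n : nat} (m : nat) : set 'rV[R]_n :=
  if unpickle m is Some (q, k) then
    ball (map_mx ratr (q : 'rV[rat]_n) : 'rV[R]_n) k.+1%:R^-1
  else set0.

Lemma open_bigcup_rational_ball (R : realType) (n : nat) (U : set 'rV[R]_n) :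
  open U ->
  U = \bigcup_(m in [set m | rational_ball m `<=` U]) rational_ball m.
Proof.
move=> oU; apply/seteqP; split=> [x Ux|x [m]]; last exact.
have /nbhs_ballP[e /= e0 xeU] : nbhs x U by exact: open_nbhs_nbhs.
have [k ke] : exists k, k.+1%:R^-1 < e / 2.
  exists (Num.truncn (e / 2)^-1); rewrite invf_plt ?posrE ?divr_gt0//.
  by rewrite truncnS_gt.
have k0 : 0 < k.+1%:R^-1 :> R by rewrite invr_gt0.
have /choice[q qP] (j : 'I_n) :
    exists r : rat, x ord0 j < ratr r < x ord0 j + k.+1%:R^-1.
  have [|r] := @rat_in_itvoo R (x ord0 j) (x ord0 j + k.+1%:R^-1).
    by rewrite ltrDl.
  by rewrite in_itv/=; exists r.
have qx : ball (map_mx ratr (\row_j q j) : 'rV[R]_n) k.+1%:R^-1 x.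
  split=> // i j; rewrite (ord1 i) !mxE /ball/=.
  by case/andP: (qP j) => q1 q2; rewrite gtr0_norm ?subr_gt0// ltrBlDl.
exists (pickle (\row_j q j, k)); rewrite /= /rational_ball pickleK//.
apply: subset_trans xeU => y qy; rewrite (splitr e).
apply: (@ball_triangle _ _ (map_mx ratr (\row_j q j) : 'rV[R]_n)).
  by apply: ball_sym; apply: le_ball qx; exact: ltW.
by apply: le_ball qy; exact: ltW.
Qed.

Lemma measurable_open_borelRn (R : realType) (n : nat) (U : set 'rV[R]_n) :
  open U -> measurable (U : set (borelRn R n)).
Proof. by move=> oU; exact: sub_sigma_algebra. Qed.

Lemma open_rational_ball (R : realType) (n m : nat) :
  open (rational_ball m : set 'rV[R]_n).
Proof.
rewrite /rational_ball; case: (unpickle m) => [[q k]|]; last exact: open0.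
apply: ball_open; by rewrite ltr0n.
Qed.

Lemma measurable_coordinate (R : realType) (n : nat) (i : 'I_n) :
  measurable_fun setT (@coordinate R n i : borelRn R n -> measurableTypeR R).
Proof.
apply: (measurability _ (RGenOpens.measurableE R)) => //.
move=> _ [_ [a [b ->] <-]]; rewrite setTI.
apply: measurable_open_borelRn.
apply: (@open_comp _ _ (fun x : 'rV[R]_n => x ord0 i) `]a, b[%classic).
  by move=> x _; exact: coord_continuous.
exact: interval_open.
Qed.

(** An open set is a countable union of rational balls, and a ball of the sup norm is a finite
    intersection of conditions on single coordinates. *)
Lemma measurable_fun_borelRn d (T : measurableType d) (R : realType) (n : nat)
    (f : T -> borelRn R n) :
  (forall i, measurable_fun setT
    (coordinate i \o f : T -> measurableTypeR R)) -> measurable_fun setT f.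
Proof.
move=> mf; apply: (@measurability _ _ _ _ setT f (@open 'rV[R]_n)) => //.
move=> _ [U oU <-]; rewrite setTI (open_bigcup_rational_ball _ _ _ oU).
rewrite preimage_bigcup; apply: bigcup_measurable => m _.
rewrite /rational_ball; case: (unpickle m) => [[q k]|]; last first.
  by rewrite preimage_set0.
set e := k.+1%:R^-1.
have -> : f @^-1` ball (map_mx ratr (q : 'rV[rat]_n) : 'rV[R]_n) e =
    \bigcap_(j in [set: 'I_n])
      ((coordinate j \o f) @^-1` ball (ratr (q ord0 j) : R) e).
  apply/seteqP; split=> [x [_ xb] j _|x xb]; last first.
    split=> [|i j]; first by rewrite invr_gt0.
    by have := xb j I; rewrite (ord1 i) mxE.
  by have := xb ord0 j; rewrite mxE.
apply: fin_bigcap_measurable => // j _; rewrite -[X in measurable X]setTI.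
apply: (mf j) => //; apply: open_measurable; exact: ball_open.
Qed.

(** For the converse, each point of [U] lies outside the support, hence in an open null set and so
    in a null rational ball. Countably many such balls cover [U]. *)
Lemma measure_supp_disjoint (R : realType) (n : nat)
    (pi : probability (borelRn R n) R) (U : set 'rV[R]_n) : open U ->
  pi U = 0%E <-> (forall x, measure_supp pi x -> ~ U x).
Proof.
move=> oU; split=> [U0 x sx Ux|sU].
  by have := sx _ oU Ux; rewrite U0 ltxx.
pose F m : set (borelRn R n) :=
  if asbool (pi (rational_ball m) = 0%E) then rational_ball m else set0.
have F0 : pi.-negligible (\bigcup_m F m).
  apply: negligible_bigcup => m; rewrite /F.
  case: asboolP => [m0|_]; last exact: negligible_set0.
  exists (rational_ball m); split => //.
  by apply: measurable_open_borelRn; exact: open_rational_ball.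
apply: measure_negligible; first exact: measurable_open_borelRn.
apply: negligibleS F0 => x Ux.
have [V [oV Vx V0]] : exists V : set 'rV[R]_n, [/\ open V, V x & pi V = 0%E].
  apply: contrapT => nV; apply: (sU x _ Ux) => V oV Vx.
  rewrite lt0e measure_ge0 andbT; apply/eqP => V0; apply: nV.
  by exists V.
move: Vx; rewrite {1}(open_bigcup_rational_ball _ _ _ oV) => -[m mV mx].
exists m => //; rewrite /F; case: asboolP => //; case.
apply: (@subset_measure0 _ _ _ pi (rational_ball m) V) => //.
  by apply: measurable_open_borelRn; exact: open_rational_ball.
exact: measurable_open_borelRn.
Qed.

(** * Distribution functions and quantile functions *)

Lemma eq_probability_rays (R : realType)
    (P Q : probability (measurableTypeR R) R) :
  (forall x, P `]-oo, x]%classic = Q `]-oo, x]%classic) ->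
  forall A : set (measurableTypeR R), measurable A -> P A = Q A.
Proof.
move=> PQ; apply: (@measure_unique _ R (measurableTypeR R) (@RGenOInfty.G R)
    (fun k => `]- k%:R, +oo[%classic) _ _ _ _ P Q) => //.
- exact: RGenOInfty.measurableE.
- move=> _ _ [x ->] [y ->]; exists (Num.max x y).
  by apply/predeqP => z; rewrite /= !in_itv/= !andbT gt_max; split => /andP.
- by move=> i; eexists.
- by rewrite -subTset => x _; exists (Num.truncn `|x|).+1 => //=;
    rewrite in_itv/= andbT ltrNl (le_lt_trans (ler_norm _))// normrN truncnS_gt.
- move=> _ [x ->]; rewrite -setCitvl.
  transitivity (1 - P `]-oo, x]%classic)%E; first exact: probability_setC.
  by rewrite PQ; exact/esym/probability_setC.
- by move=> k; rewrite (le_lt_trans (probability_le1 _ _))// ltry.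
Qed.

Definition distr_fun {R : realType} (mu : probability (measurableTypeR R) R)
  (x : R) : R := fine (mu `]-oo, x]%classic).

Section distribution_function.
Context (R : realType) (mu : probability (measurableTypeR R) R).
Local Notation F := (distr_fun mu).

Lemma EFin_distr_fun x : (F x)%:E = mu `]-oo, x]%classic.
Proof. by rewrite fineK// fin_num_measure. Qed.

Lemma distr_fun_ge0 x : 0 <= F x.
Proof. by rewrite -lee_fin EFin_distr_fun. Qed.

Lemma distr_fun_le1 x : F x <= 1.
Proof. by rewrite -lee_fin EFin_distr_fun probability_le1. Qed.

Lemma distr_fun_ndecr : nondecreasing F.
Proof.
move=> x y xy; rewrite -lee_fin !EFin_distr_fun.
by apply: le_measure; rewrite ?inE//; exact: subset_itvl.
Qed.

(** Taking the identity as random variable transfers to [F] the limits and the right continuity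
    known for [cdf]. *)
Lemma cdf_distr_fun :
  exists X : {RV mu >-> R}, cdf X = EFin \o F.
Proof.
pose idR : measurableTypeR R -> R := idfun.
pose m := @isMeasurableFun.Build _ _ _ _ idR (@measurable_id _ _ setT).
pose X : {mfun measurableTypeR R >-> R} := HB.pack idR m.
by exists X; apply/funext => x; rewrite /= EFin_distr_fun.
Qed.

Lemma distr_funNy : F @ -oo --> (0 : R).
Proof.
have [X XF] := cdf_distr_fun.
have -> : F = fine \o cdf X by rewrite XF.
by apply: fine_cvg; exact: cvg_cdfNy0.
Qed.

Lemma distr_funy : F @ +oo --> (1 : R).
Proof.
have [X XF] := cdf_distr_fun.
have -> : F = fine \o cdf X by rewrite XF.
by apply: fine_cvg; exact: cvg_cdfy1.
Qed.

Lemma distr_fun_right_continuous : right_continuous F.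
Proof.
move=> a; have [X XF] := cdf_distr_fun.
have -> : F = fine \o cdf X by rewrite XF.
apply: fine_cvg; have := @cdf_right_continuous _ _ _ _ X a.
by rewrite XF.
Qed.

(** For left continuity, the rays [B k] increase to []-oo, a[], which has the same mass as []-oo,
    a]] because [a] is not an atom. *)
Lemma distr_fun_continuous : atomless mu -> continuous F.
Proof.
move=> mu0 a; apply/left_right_continuousP; split; last first.
  exact: distr_fun_right_continuous.
have left_approx : forall e, 0 < e -> exists2 b, b < a & F a - e < F b.
  move=> e e0.
  pose B k : set (measurableTypeR R) := `]-oo, a - k.+1%:R^-1]%classic.
  have B_cvg : fine (mu (B k)) @[k --> \oo] --> F a.
    have -> : F a = fine (mu (\bigcup_k B k)).
      have -> : \bigcup_k B k = `]-oo, a[%classic.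
        apply/seteqP; split=> [x [k _]|x] /=; rewrite /B /= !in_itv/=.
          by move=> /le_lt_trans; apply; rewrite ltrBlDr ltrDl invr_gt0.
        rewrite -subr_gt0 => xa.
        exists (Num.truncn (a - x)^-1) => //=; rewrite in_itv/= lerBrDr.
        by rewrite addrC -lerBrDr invf_ple ?posrE// ltW// truncnS_gt.
      by rewrite /distr_fun -(@setUitv1 _ _ _ _ true)// measureU0//; exact: mu0.
    have mB : measurable (\bigcup_k B k)
      by apply: bigcup_measurable => k _; exact: measurable_itv.
    apply: fine_cvg; rewrite fineK ?fin_num_measure//.
    apply: nondecreasing_cvg_mu => //; first by move=> k; exact: measurable_itv.
    move=> m n mn; apply/subsetPset; apply: subset_itvl.
    by rewrite bnd_simp lerB// lef_pV2 ?posrE// ler_nat.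
  have FaB : F a - e < F a by rewrite ltrBlDr ltrDl.
  have [k _ /(_ k (leqnn k)) ak] := cvgr_gt _ B_cvg _ FaB.
  by exists (a - k.+1%:R^-1); rewrite // ltrBlDr ltrDl.
apply/cvgrPdist_lt => e e0.
have [b ab Fb] := left_approx e e0.
near=> x.
rewrite ger0_norm; last by rewrite subr_ge0 distr_fun_ndecr//.
rewrite ltrBlDr -ltrBlDl (lt_le_trans Fb)// distr_fun_ndecr//.
by near: x; exact: nbhs_left_ge.
Unshelve. all: by end_near. Qed.

End distribution_function.

(* Outside ]0, 1[ the set may be empty or unbounded below, and its [inf]
   meaningless: the value there is [d]. *)
Definition quantile {R : realType} (mu : probability (measurableTypeR R) R)
  (d t : R) : R := if 0 < t < 1 then inf [set x | t <= distr_fun mu x] else d.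

Section quantile.
Context (R : realType) (mu : probability (measurableTypeR R) R) (d : R).
Local Notation F := (distr_fun mu).
Local Notation Q := (quantile mu d).

(** The limits of [F] at both infinities make [E] nonempty and bounded below, and right continuity
    of [F] shows that the infimum is attained; this gives the Galois connection. *)
Lemma quantile_le t x : 0 < t < 1 -> (Q t <= x) = (t <= F x).
Proof.
move=> t01; rewrite /quantile t01; case/andP: t01 => t0 t1.
set E := [set x | t <= F x].
have infE : has_inf E.
  split; have tF : \forall x \near (-oo : set_system R), F x < t.
  - exact: cvgr_lt _ (distr_funNy _ mu) _ t0.
  - have /filter_ex[y ty] : \forall x \near (+oo : set_system R), t < F x.
      exact: cvgr_gt _ (distr_funy _ mu) _ t1.
    by exists y; exact: ltW.
  - exact: cvgr_lt _ (distr_funNy _ mu) _ t0.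
  - have /filter_ex[y Fyt] := tF.
    exists y => z /= tFz; rewrite leNgt; apply/negP => zy.
    by have := lt_le_trans Fyt tFz; rewrite ltNge distr_fun_ndecr// ltW.
apply/idP/idP => [Ex|tFx]; last by apply: ge_inf => //; case: infE.
apply: (@le_trans _ _ (F (inf E))); last exact: distr_fun_ndecr.
rewrite leNgt; apply/negP => FEt.
have nF : \forall y \near (inf E)^'+, F y < t.
  exact: cvgr_lt _ (distr_fun_right_continuous _ mu _) _ FEt.
have /filter_ex[y [yE Fyt]] : \forall y \near (inf E)^'+, inf E < y /\ F y < t.
  by near=> y; split; near: y => //; exact: nbhs_right_gt.
have [|z /= tFz] := @inf_adherent _ E (y - inf E) _ infE.
  by rewrite subr_gt0.
rewrite addrC subrK => zy.
by have := le_lt_trans tFz (le_lt_trans (distr_fun_ndecr _ _ _ _ (ltW zy)) Fyt);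
  rewrite ltxx.
Unshelve. all: by end_near. Qed.

Lemma measurable_quantile : measurable_fun setT (Q : R -> R).
Proof.
apply: (measurability _ (RGenOInfty.measurableE R)) => //.
move=> _ [_ [x ->] <-]; rewrite setTI.
rewrite (_ : _ @^-1` _ = ~` [set t | Q t <= x]); last first.
  by apply/predeqP => t /=; rewrite in_itv/= andbT ltNge; split => /negP.
apply: measurableC; rewrite (_ : [set _ | _] =
    (`]0, 1[ `&` `]-oo, F x]) `|`
    (~` `]0, 1[ `&` [set _ | d <= x])); last first.
  apply/seteqP; split=> [t|t []] /=; rewrite !in_itv/=.
  - have [t01|t01] := boolP (0 < t < 1); first by rewrite quantile_le//; left.
    by rewrite /quantile (negbTE t01); right.
  - by case=> t01; rewrite quantile_le.
  - by case=> /negP/negbTE t01; rewrite /quantile t01.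
apply: measurableU; first exact: measurableI.
apply: measurableI; first exact: measurableC.
by case: (d <= x); [rewrite (_ : [set _ | _] = setT)//; apply/seteqP; split
  |rewrite (_ : [set _ | _] = set0)//; apply/seteqP; split].
Qed.

End quantile.

(* Rotation of ]0, 1] sending p to 1. *)
Definition rotation {R : realType} (p u : R) : R :=
  if p < u then u - p else u - p + 1.

Lemma measurable_rotation (R : realType) (p : R) :
  measurable_fun setT (rotation p).
Proof.
apply: measurable_fun_if => //.
- exact: measurable_fun_ltr.
- by apply: measurable_funTS; apply: measurable_funB.
- apply: measurable_funTS; apply: measurable_funD => //.
  exact: measurable_funB.
Qed.

(** * Rotated uniform variables and their quantile transforms *)

Section uniform.
Context {R : realType}.
Local Notation U := (uniform_prob (@ltr01 R)).

Lemma uniform_prob01 (A : set R) : measurable A ->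
  U A = lebesgue_measure (A `&` `[0, 1]).
Proof.
move=> mA; rewrite /uniform_prob integral_uniform_pdf.
rewrite (eq_integral (cst 1%E)); last first.
  by move=> x /[!inE] -[_ /=]; rewrite in_itv/= /uniform_pdf => ->;
    rewrite subr0 invr1.
by rewrite integral_cst ?mul1e//; exact: measurableI.
Qed.

(** Within [[0, 1]] the event is an interval starting at [p], cut off at 1, together with the part
    that wraps around to 0; the lengths add up to [a]. *)
Lemma uniform_rotation (p a : R) : 0 <= p <= 1 -> 0 <= a <= 1 ->
  U [set u | rotation p u <= a] = a%:E.
Proof.
move=> p01 a01; rewrite uniform_prob01; last first.
  rewrite -[X in measurable X]setTI.
  apply: (measurable_rotation _ p _ `]-oo, a]%classic) => //.
have -> : [set u | rotation p u <= a] `&` `[0, 1] =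
    `]p, Num.min 1 (p + a)] `|` `[0, p + a - 1].
  apply/seteqP; split=> u /=; rewrite /rotation !in_itv/= le_min.
    case: ltP => pu [] ? /andP[? ?]; [left|right]; apply/andP; split; lra.
  case: ltP => pu []; lra.
rewrite measureU//; last first.
  apply/seteqP; split => // u /= [].
  by rewrite !in_itv/= => /andP[? _] /andP[_ ?]; lra.
apply: (etrans (congr2 _ (lebesgue_measure_itv `]p, Num.min 1 (p + a)])
  (lebesgue_measure_itv `[0, p + a - 1]))).
rewrite /= !lte_fin.
have [?|?] := leP 1 (p + a); case: ifPn => ?; case: ifPn => ?;
  rewrite -?EFinD ?(adde0, add0e) -?EFinD; first [congr _%:E; lra | lra].
Qed.

End uniform.

Lemma uniform_quantile_rotation (R : realType)
    (mu : probability (measurableTypeR R) R) (d p x : R) : 0 <= p <= 1 ->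
  uniform_prob (@ltr01 R) [set u | quantile mu d (rotation p u) <= x] =
  mu `]-oo, x]%classic.
Proof.
move=> p01; set U := uniform_prob _.
have mle (f : R -> R) y :
    measurable_fun setT f -> measurable [set u | f u <= y].
  move=> mf; rewrite -[X in measurable X]setTI.
  exact: (mf _ `]-oo, y]%classic).
(* On [Z] the quantile takes its default value. Inside [[0, 1]] this can happen only at 0, [p] and
   1. *)
pose Z := ~` [set u | 0 < rotation p u < 1].
have mZ : measurable Z.
  apply: measurableC; rewrite -[X in measurable X]setTI.
  exact: (measurable_rotation _ _ _ `]0, 1[%classic).
have Z0 : U Z = 0%E.
  rewrite /U uniform_prob01//.
  apply: (@subset_measure0 _ _ _ lebesgue_measure _ [set 0; p; 1]) => //.
  - exact: measurableI.
  - by apply: measurableU => //; exact: measurableU.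
  - move=> u []; rewrite /Z /= in_itv/= /rotation => h u01.
    have [->|u0] := eqVneq u 0; first by left; left.
    have [->|up] := eqVneq u p; first by left; right.
    have [->|u1] := eqVneq u 1; first by right.
    exfalso; apply: h.
    have {}u0 : 0 < u by rewrite lt_neqAle eq_sym u0; case/andP: u01.
    have {}u1 : u < 1 by rewrite lt_neqAle u1; case/andP: u01.
    case: (ltP p u) => pu; first by apply/andP; split; lra.
    have {}up : u < p by rewrite lt_neqAle up.
    by apply/andP; split; lra.
  - apply: countable_lebesgue_measure0; apply: finite_set_countable.
    by rewrite !finite_setU; split => //; split.
have mA := mle _ x (measurableT_comp (measurable_quantile _ mu d)
  (measurable_rotation _ p)).
have mB := mle _ (distr_fun mu x) (measurable_rotation _ p).
rewrite -EFin_distr_fun -(uniform_rotation p (distr_fun mu x)) //; last first.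
  by rewrite distr_fun_ge0 distr_fun_le1.
(* Adjoining the null set [Z] to both events makes them equal: off [Z], [quantile_le] identifies
   them. *)
have UZ (A : set (measurableTypeR R)) : measurable A -> U (A `|` Z) = U A.
  by move=> mA'; exact: measureU0.
rewrite -/U -[LHS]UZ// -[RHS]UZ//.
congr (U _); apply/seteqP; split=> u;
  have [h|h] := pselect (0 < rotation p u < 1); try by right.
  by move=> [/=|]; [rewrite quantile_le//; left|right].
by move=> [/=|]; [rewrite -(quantile_le _ mu d)//; left|right].
Qed.

(** * Consecutive intervals with prescribed lengths *)

Section partial_sums.
Context {R : realType} {n : nat} (p : 'I_n -> R).
Hypothesis p_ge0 : forall i, 0 <= p i.
Hypothesis p_sum1 : \sum_(i < n) p i = 1.

Definition psum (m : nat) : R := \sum_(k < n | (k < m)%N) p k.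

Lemma psum0 : psum 0 = 0.
Proof. by rewrite /psum big_pred0. Qed.

Lemma psumn : psum n = 1.
Proof. by rewrite -p_sum1; apply: eq_bigl => k; rewrite ltn_ord. Qed.

Lemma psumS (i : 'I_n) : psum i.+1 = psum i + p i.
Proof.
rewrite /psum (bigD1 i)//= addrC; congr (_ + _); apply: eq_bigl => k.
by rewrite ltnS [RHS]ltn_neqAle andbC.
Qed.

Lemma psum_ndecr l m : (l <= m)%N -> psum l <= psum m.
Proof.
move=> lm; rewrite /psum big_mkcond [leRHS]big_mkcond/=; apply: ler_sum => k _.
by case: ifPn => [kl|_]; [rewrite (leq_trans kl lm)|case: ifP].
Qed.

Lemma psum01 (i : 'I_n) : 0 <= psum i <= 1.
Proof. by rewrite -psum0 -psumn !psum_ndecr// ltnW. Qed.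

(** If [u <= psum i], the rotated value is [u - psum i + 1], which exceeds [p i] since
    [psum i + p i <= 1] and [0 < u]. *)
Lemma rotation_psum_le (i : 'I_n) u : 0 < u <= 1 ->
  (rotation (psum i) u <= p i) = (psum i < u <= psum i.+1).
Proof.
move=> u01; have := psum01 i; have := p_ge0 i.
have : psum i.+1 <= 1 by rewrite -psumn psum_ndecr.
rewrite /rotation psumS; case: ltP => /= ? ? ? ?; first by rewrite lerBlDl.
by apply/negbTE; rewrite -ltNge; lra.
Qed.

Lemma psum_cover u : 0 < u <= 1 -> exists i : 'I_n, psum i < u <= psum i.+1.
Proof.
case/andP=> u0; rewrite -psumn.
have : (n <= n)%N by [].
(* Induction on the bound [m] in [u <= psum m]; the index type ['I_n] stays fixed. *)
elim: {1 3}n => [|m IH] mn; first by rewrite psum0 leNgt u0.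
move=> um; have [/IH|mu] := leP u (psum m); first by apply; exact: ltnW.
by exists (Ordinal mn); rewrite mu.
Qed.

Lemma psum_disjoint (i j : 'I_n) u : psum i < u <= psum i.+1 ->
  psum j < u <= psum j.+1 -> i = j.
Proof.
wlog ij : i j / (i <= j)%N.
  by move=> H Hi Hj; case/orP: (leq_total i j) => h; [exact: H|apply/esym/H].
case/andP=> _ ui /andP[uj _]; apply/val_inj/eqP; rewrite eqn_leq ij/= leqNgt.
apply/negP => /psum_ndecr => h.
by have := lt_le_trans uj (le_trans ui h); rewrite ltxx.
Qed.

End partial_sums.

(** * The open set of points violating the support conditions *)

Definition misplaced {R : realType} {n : nat} (s : R) : set 'rV[R]_n :=
  [set x | exists i j, [/\ j != i, x ord0 i < s & x ord0 j < s]] `|`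
  [set x | forall i, s < x ord0 i].

Lemma open_misplaced (R : realType) (n : nat) (s : R) :
  open (misplaced s : set 'rV[R]_n).
Proof.
have olt (i : 'I_n) : open [set x : 'rV[R]_n | x ord0 i < s].
  apply: (@open_comp _ _ (fun x : 'rV[R]_n => x ord0 i) [set y | y < s]).
    by move=> x _; exact: coord_continuous.
  exact: open_lt.
have ogt (i : 'I_n) : open [set x : 'rV[R]_n | s < x ord0 i].
  apply: (@open_comp _ _ (fun x : 'rV[R]_n => x ord0 i) [set y | s < y]).
    by move=> x _; exact: coord_continuous.
  exact: open_gt.
apply: openU.
  rewrite (_ : [set _ | _] =
      \bigcup_(ij in [set ij : 'I_n * 'I_n | ij.2 != ij.1])
        ([set x | x ord0 ij.1 < s] `&` [set x | x ord0 ij.2 < s])).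
    by apply: bigcup_open => -[i j] _; apply: openI; exact: olt.
  apply/seteqP; split=> [x [i [j [ij xi xj]]]|x [[i j]/= ij [xi xj]]].
    by exists (i, j).
  by exists i, j.
rewrite openE => x sx; rewrite /interior /=.
apply: (@filter_forall _ 'I_n (fun i => [set y | s < y ord0 i]) (nbhs x)) => i.
by apply: open_nbhs_nbhs; split; [exact: ogt|exact: sx].
Qed.

Lemma not_misplacedP (R : realType) (n : nat) (s : R) (x : 'rV[R]_n) :
  (0 < n)%N -> ~ misplaced s x <->
  forall i, (x ord0 i < s -> forall j, j != i -> s <= x ord0 j) /\
    (s < x ord0 i -> exists j, j != i /\ x ord0 j <= s).
Proof.
move=> n0; split=> [xs i|xs].
  split=> [xi j ji|xi].
    by rewrite leNgt; apply/negP => xj; apply: xs; left; exists i, j.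
  apply: contrapT => nj; apply: xs; right => j; rewrite ltNge; apply/negP => xj.
  apply: nj; exists j; split => //; apply/negP => /eqP ji.
  by move: xj; rewrite ji leNgt xi.
case=> [[i [j [ji xi xj]]]|xi].
  by have := (xs i).1 xi j ji; rewrite leNgt xj.
have [j [_]] := (xs (Ordinal n0)).2 (xi _); by rewrite leNgt xi.
Qed.

(** * Construction of a coupling with zero gap *)

Section optimal_coupling.
Context {R : realType} {n : nat}.
Variable mu : 'I_n -> probability (measurableTypeR R) R.
Variable s : R.
Hypothesis mu_s : \sum_(i < n) distr_fun (mu i) s = 1.
Local Notation p := (fun i : 'I_n => distr_fun (mu i) s).

(** The default value [s] of the quantile satisfies the conclusions of both [T_le] and [T_ge], so
    these hold for every [u]. *)
Let T (u : measurableTypeR R) : borelRn R n :=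
  \row_i quantile (mu i) s (rotation (psum p i) u).

Let T_le (i : 'I_n) u : rotation (psum p i) u <= p i -> coordinate i (T u) <= s.
Proof.
rewrite /coordinate mxE; have [h|h] := boolP (0 < rotation (psum p i) u < 1).
  by rewrite quantile_le.
by rewrite /quantile (negbTE h).
Qed.

Let T_ge (i : 'I_n) u : p i < rotation (psum p i) u -> s <= coordinate i (T u).
Proof.
rewrite /coordinate mxE; have [h|h] := boolP (0 < rotation (psum p i) u < 1).
  by rewrite ltNge -(quantile_le _ (mu i) s _ _ h) -ltNge => /ltW.
by rewrite /quantile (negbTE h).
Qed.

Let measurable_T : measurable_fun setT T.
Proof.
apply: measurable_fun_borelRn => i.
rewrite (_ : _ \o _ = quantile (mu i) s \o rotation (psum p i)); last first.
  by apply/funext => u; rewrite /= /coordinate mxE.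
exact: (measurableT_comp (measurable_quantile _ (mu i) s)
  (measurable_rotation _ _)).
Qed.

Lemma exists_coupling_misplaced0 :
  exists2 pi : probability (borelRn R n) R,
    coupling mu pi & pi (misplaced s) = 0%E.
Proof.
pose m := @isMeasurableFun.Build _ _ _ _ T measurable_T.
pose X : {mfun measurableTypeR R >-> borelRn R n} := HB.pack T m.
have p_ge0 i : 0 <= p i by exact: distr_fun_ge0.
exists (distribution (uniform_prob (@ltr01 R)) X).
  move=> i A mA.
  have mC := @measurable_coordinate R n i.
  pose mi := @isMeasurableFun.Build _ _ _ _ _ mC.
  pose C : {mfun borelRn R n >-> measurableTypeR R} :=
    HB.pack (@coordinate R n i) mi.
  apply: (@eq_probability_rays R
    (distribution (distribution (uniform_prob (@ltr01 R)) X) C) (mu i)) => // x.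
  rewrite -(uniform_quantile_rotation _ (mu i) s (psum p i)) ?psum01//.
  rewrite /distribution /pushforward; apply: (congr1 (uniform_prob (@ltr01 R))).
  by apply/seteqP; split=> u; rewrite /= in_itv/= /coordinate mxE.
have mTN : measurable (T @^-1` misplaced s).
  rewrite -[X in measurable X]setTI; apply: measurable_T => //.
  by apply: measurable_open_borelRn; exact: open_misplaced.
transitivity (lebesgue_measure (T @^-1` misplaced s `&` `[0, 1])).
  exact: uniform_prob01.
(* In [[0, 1]] only 0 escapes the half-open intervals. For any other [u], its interval provides a
   coordinate [<= s], and two coordinates [< s] would put [u] in two intervals. *)
apply: (@subset_measure0 _ _ _ lebesgue_measure _ [set 0]) => //.
- exact: measurableI.
- move=> u [Nu]; rewrite /= in_itv/= => /andP[u0 u1].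
  apply: contrapT => /eqP u_neq0.
  have u01 : 0 < u <= 1 by rewrite lt_neqAle eq_sym u_neq0 u0.
  have [i iu] := psum_cover _ mu_s _ u01.
  have Ti := T_le i u; rewrite rotation_psum_le// in Ti.
  case: Nu => [[j [k [kj Tj Tk]]]|/(_ i)]; last by rewrite ltNge Ti.
  have jP l : T u ord0 l < s -> psum p l < u <= psum p l.+1.
    move=> Tl; rewrite -rotation_psum_le// leNgt; apply/negP => /T_ge.
    by rewrite leNgt Tl.
  by move: kj; rewrite (psum_disjoint _ p_ge0 _ _ _ (jP _ Tj) (jP _ Tk)) eqxx.
- exact: lebesgue_measure_set1.
Qed.

End optimal_coupling.

(** * The threshold and the sum of the distribution functions *)

Lemma cvg_sum_ord (R : realType) (T : Type) (F : set_system T) {FF : Filter F}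
    (n : nat) (f : 'I_n -> T -> R) (l : 'I_n -> R) :
  (forall i, f i @ F --> l i) ->
  (fun x => \sum_(i < n) f i x) @ F --> \sum_(i < n) l i.
Proof.
move=> fl; rewrite (_ : (fun _ => _) = \sum_(i < n) f i); last first.
  by apply/funext => x; rewrite fct_sumE.
elim/big_ind2 : _ => [|g a h b ga hb|i _]; last exact: fl.
  exact: cvg_cst.
exact: cvgD.
Qed.

(** The sum [G] is continuous and nondecreasing from 0 to [n > 1], so [E] has a supremum. If
    [G s > 1], points of [E] close to [s] give a contradiction; if [G s < 1], points slightly above
    [s] would belong to [E]. *)
Lemma sum_distr_fun_threshold (R : realType) (n : nat)
    (mu : 'I_n -> probability (measurableTypeR R) R) : (1 < n)%N ->
  (forall i, atomless (mu i)) ->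
  \sum_(i < n) distr_fun (mu i) (threshold mu) = 1.
Proof.
move=> n1 mu0; set s := threshold mu.
pose G x := \sum_(i < n) distr_fun (mu i) x.
pose E := [set x : R | (\sum_(i < n) mu i `]-oo, x]%classic <= 1)%E].
have EG x : E x <-> G x <= 1.
  rewrite /E /= -lee_fin /G -sumEFin.
  by under [X in _ <-> is_true (X <= _)%E]eq_bigr do rewrite EFin_distr_fun.
have G_ndecr x y : x <= y -> G x <= G y.
  by move=> xy; apply: ler_sum => i _; exact: distr_fun_ndecr.
have G_cont : G x @[x --> s] --> G s.
  by apply: cvg_sum_ord => i; exact: distr_fun_continuous.
have [a Ea] : exists a, G a < 1.
  have G0 : G x @[x --> -oo] --> \sum_(i < n) (0 : R).
    by apply: cvg_sum_ord => i; exact: distr_funNy.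
  have /filter_ex[a Ga] : \forall x \near (-oo : set_system R), G x < 1.
    by apply: cvgr_lt G0 _ _; rewrite big1.
  by exists a.
have [b Eb] : exists b, 1 < G b.
  have G1 : G x @[x --> +oo] --> \sum_(i < n) (1 : R).
    by apply: cvg_sum_ord => i; exact: distr_funy.
  have /filter_ex[b Gb] : \forall x \near (+oo : set_system R), 1 < G x.
    by apply: cvgr_gt G1 _ _; rewrite sumr_const card_ord ltr1n.
  by exists b.
have supE : has_sup E.
  split; first by exists a; apply/EG; exact: ltW.
  exists b => x /EG Gx; rewrite leNgt; apply/negP => /ltW/G_ndecr.
  by rewrite leNgt (le_lt_trans Gx).
apply/eqP; rewrite eq_le; apply/andP; split; rewrite leNgt; apply/negP => Gs.
  have /nbhs_ballP[e /= e0 He] : \forall x \near s, 1 < G x.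
    exact: cvgr_gt G_cont _ Gs.
  have [y /EG Gy sy] := sup_adherent e0 supE.
  have ys : y <= s by apply: ub_le_sup; [case: supE|apply/EG].
  suff : 1 < G y by rewrite ltNge Gy.
  apply: He; rewrite /ball/= ger0_norm ?subr_ge0//.
  by rewrite ltrBlDl -ltrBlDr.
have /nbhs_ballP[e /= e0 He] : \forall x \near s, G x < 1.
  exact: cvgr_lt G_cont _ Gs.
have Gse : G (s + e / 2) < 1.
  apply: He; rewrite /ball/= opprD addrA subrr add0r normrN.
  by rewrite gtr0_norm ?divr_gt0// ltr_pdivrMr// ltr_pMr// ltr1n.
have : s + e / 2 <= s.
  by apply: ub_le_sup; [case: supE|apply/EG; exact: ltW].
by rewrite leNgt ltrDl divr_gt0.
Qed.

(** * The dual bound and its gap *)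

(** If [f] is not integrable, both sides are [+oo]: the negative part of [f - g] is at most [|g|],
    and a finite integral of its positive part would make [f = (f - g) + g] integrable. This covers
    gaps of infinite integral. *)
Lemma integralB_ge0 d (T : measurableType d) (R : realType)
    (m : {measure set T -> \bar R}) (f g : T -> R) :
  measurable_fun setT f -> (forall x, 0 <= f x) ->
  m.-integrable setT (EFin \o g) ->
  (\int[m]_x (f x - g x)%:E = \int[m]_x (f x)%:E - \int[m]_x (g x)%:E)%E.
Proof.
move=> mf f0 ig.
have mg : measurable_fun setT g by apply/measurable_EFinP; case/integrableP: ig.
have [fi|nfi] := pselect (m.-integrable setT (EFin \o f)).
  by rewrite -integralB_EFin.
pose h x := (f x - g x)%:E.
have mh : measurable_fun setT h.
  by apply/measurable_EFinP; exact: measurable_funB.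
have gfin : (\int[m]_x (g x)%:E)%E \is a fin_num by exact: integrable_fin_num.
have foo : (\int[m]_x (f x)%:E = +oo)%E.
  apply/eqP; rewrite -leye_eq leNgt; apply/negP => fi; apply: nfi.
  apply/integrableP; split; first exact/measurable_EFinP.
  by under eq_integral => x _ do rewrite /= ger0_norm//.
have fgN : (\int[m]_x h^\- x < +oo)%E.
  case/integrableP: ig => _; apply: le_lt_trans; apply: ge0_le_integral => //.
  - exact: measurable_funeneg.
  - by apply: measurableT_comp => //; exact/measurable_EFinP.
  - move=> x _; rewrite funenegE -EFinN -EFin_max lee_fin ge_max normr_ge0.
    by rewrite andbT opprB lerBlDr (le_trans (ler_norm _))// lerDl.
have fgP : (\int[m]_x h^\+ x = +oo)%E.
  apply/eqP; rewrite -leye_eq leNgt; apply/negP => fgi; apply: nfi.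
  have fg : m.-integrable setT h.
    apply/integrableP; split => //.
    rewrite (eq_integral (h^\+ \+ h^\-)%E); last first.
      by move=> x _; exact: (congr1 (fun k => k x) (fune_abse h)).
    rewrite ge0_integralD//; first exact: lte_add_pinfty.
    - exact: measurable_funepos.
    - exact: measurable_funeneg.
  have := integrableD measurableT fg ig.
  by apply: eq_integrable => // x _; rewrite /= -EFinD subrK.
rewrite -/(h _) integralE fgP foo.
rewrite !addye// eqe_oppLR/=; apply/eqP => I; last by rewrite I in fgN.
by rewrite I in gfin.
Qed.

Lemma integral_cst_probability d (T : measurableType d) (R : realType)
  (P : probability T R) (r : R) : (\int[P]_x r%:E = r%:E)%E.
Proof. by rewrite (integral_cst P measurableT)/= probability_setT mule1. Qed.

Section gap.
Context {R : realType} {n : nat} (s : R).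
Hypothesis n_gt0 : (0 < n)%N.
Implicit Types x : borelRn R n.

Lemma min_costP x : exists i, min_cost x = (coordinate i x)%:E /\
  forall j, coordinate i x <= coordinate j x.
Proof.
have [i] := Order.TotalTheory.arg_minP (fun i => coordinate i x)
  (isT : xpredT (Ordinal n_gt0)).
move=> _ xi; exists i; split => [|j]; last exact: xi.
apply/eqP; rewrite eq_le; apply/andP; split; first exact: bigmin_le.
by apply: le_bigmin => [|j _]; rewrite ?leey// lee_fin xi.
Qed.

(** A sum of functions of one coordinate each, so its integral depends on the marginals only. *)
Definition shortfall x : R := \sum_(i < n) Num.max (s - coordinate i x) 0.

(* [min x >= s - shortfall x] is the dual bound. *)
Definition gap x : R := fine (min_cost x) + shortfall x - s.

Lemma shortfall_split x i : shortfall x =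
  Num.max (s - coordinate i x) 0 +
  \sum_(j < n | j != i) Num.max (s - coordinate j x) 0.
Proof. by rewrite /shortfall (bigD1 i). Qed.

Lemma gap_ge0 x : 0 <= gap x.
Proof.
have [i [ci _]] := min_costP x; rewrite /gap ci (shortfall_split _ i) /=.
set S := \sum_(_ < _ | _) _.
have : 0 <= S by apply: sumr_ge0 => j _; rewrite le_max lexx orbT.
have : s - coordinate i x <= Num.max (s - coordinate i x) 0.
  by rewrite le_max lexx.
lra.
Qed.

(** At a minimal coordinate [i] the gap is the sum of [x_i + max (s - x_i) 0 - s] and [S], both
    nonnegative. The first vanishes when [x_i <= s], the second when all other coordinates are
    [>= s]. *)
Lemma gap_eq0 x : gap x = 0 <-> ~ misplaced s x.
Proof.
have [i [ci xi]] := min_costP x; rewrite /gap ci (shortfall_split _ i) /=.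
set S := \sum_(_ < _ | _) _.
have S_ge0 j : j != i -> 0 <= Num.max (s - coordinate j x) 0.
  by rewrite le_max lexx orbT.
have S0 : 0 <= S by apply: sumr_ge0 => j /S_ge0.
have S_eq0 : S = 0 <-> forall j, j != i -> s <= coordinate j x.
  split=> [/eqP|xs]; last first.
    by apply: big1 => j /xs sj; apply/max_idPr; rewrite subr_le0.
  rewrite psumr_eq0// => /allP Sj j ji.
  have := Sj j (mem_index_enum j); rewrite ji /= => /eqP/max_idPr.
  by rewrite subr_le0.
split=> [g0|nx].
  have xis : coordinate i x <= s.
    have : 0 <= Num.max (s - coordinate i x) 0 by rewrite le_max lexx orbT.
    lra.
  have : S = 0.
    have : s - coordinate i x <= Num.max (s - coordinate i x) 0.
      by rewrite le_max lexx.
    lra.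
  move/S_eq0 => xs [[j [k [kj xj xk]]]|/(_ i)]; last by rewrite ltNge xis.
  have [ji|ji] := eqVneq j i.
    by have := xs k; rewrite -ji kj leNgt xk => /(_ isT).
  by have := xs j ji; rewrite leNgt xj.
have xis : coordinate i x <= s.
  rewrite leNgt; apply/negP => si; apply: nx; right => j.
  exact: lt_le_trans si (xi j).
have /max_idPl -> : 0 <= s - coordinate i x by rewrite subr_ge0.
suff -> : S = 0 by ring.
apply/S_eq0 => j ji; move: xis; rewrite le_eqVlt => /predU1P[<-//|xis].
rewrite leNgt; apply/negP => xj; apply: nx; left.
by exists i, j.
Qed.

Lemma measurable_min_cost : measurable_fun setT (@min_cost R n).
Proof.
rewrite /min_cost; elim: (index_enum _) => [|i r IH].
  by under eq_fun do rewrite big_nil; exact: measurable_cst.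
under eq_fun do rewrite big_cons.
apply: measurable_mine => //.
by apply/measurable_EFinP; exact: measurable_coordinate.
Qed.

Lemma measurable_shortfall : measurable_fun setT (fun x => shortfall x).
Proof.
apply: measurable_sum => i; apply: measurable_maxr => //.
by apply: measurable_funB => //; exact: measurable_coordinate.
Qed.

Lemma measurable_gap : measurable_fun setT gap.
Proof.
apply: measurable_funB => //; apply: measurable_funD.
  by apply: measurableT_comp => //; exact: measurable_min_cost.
exact: measurable_shortfall.
Qed.

Lemma integral_gap_eq0 (pi : probability (borelRn R n) R) :
  (\int[pi]_x (gap x)%:E = 0)%E <-> pi (misplaced s) = 0%E.
Proof.
have mN : measurable (misplaced s : set (borelRn R n)).
  by apply: measurable_open_borelRn; exact: open_misplaced.
have mg : measurable_fun setT (fun x => (gap x)%:E).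
  by apply/measurable_EFinP; exact: measurable_gap.
have := ae_eq_integral_abs pi measurableT mg.
under eq_integral => x _ do rewrite gee0_abs ?lee_fin ?gap_ge0//.
move=> ->; split=> [[N [mN' N0 gN]]|N0].
  apply: (@subset_measure0 _ _ _ pi (misplaced s) N) => // x Nx.
  by apply: gN => /= /(_ I) [] /gap_eq0.
exists (misplaced s); split => // x /= /not_implyP[_ gx].
by apply: contrapT => /gap_eq0 g0; apply: gx; rewrite g0.
Qed.

Variable mu : 'I_n -> probability (measurableTypeR R) R.
Hypothesis mu_neg : forall i, integrable_neg_part (mu i).

Let I i := (\int[mu i]_t (Num.max (s - t) 0)%:E)%E.

(** The integrand is at most [|s| + max (- t) 0], whose integral is finite by [mu_neg]. *)
Let I_lty i : (I i < +oo)%E.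
Proof.
apply: (@le_lt_trans _ _ (\int[mu i]_t (`|s|%:E + (Num.max (- t) 0)%:E))%E).
  apply: ge0_le_integral => //.
  - by move=> t _; rewrite lee_fin le_max lexx orbT.
  - apply/measurable_EFinP; apply: measurable_maxr => //.
    exact: measurable_funB.
  - apply/measurable_EFinP; apply: measurable_funD => //.
    exact: measurable_maxr.
  - move=> t _; rewrite -EFinD lee_fin ge_max.
    have := ler_norm s; have : - t <= Num.max (- t) 0 by rewrite le_max lexx.
    have : 0 <= Num.max (- t) 0 by rewrite le_max lexx orbT.
    have := normr_ge0 s.
    by move=> *; apply/andP; split; lra.
rewrite ge0_integralD//=.
- apply: lte_add_pinfty; last exact: mu_neg.
  by rewrite integral_cst_probability ltry.
- by move=> t _; rewrite lee_fin le_max lexx orbT.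
- by apply/measurable_EFinP; apply: measurable_maxr.
Qed.

Lemma integral_coordinate (pi : probability (borelRn R n) R) i (f : R -> R) :
  coupling mu pi -> measurable_fun setT f -> (forall t, 0 <= f t) ->
  (\int[pi]_x (f (coordinate i x))%:E = \int[mu i]_t (f t)%:E)%E.
Proof.
move=> pimu mf f0.
have mC := @measurable_coordinate R n i.
rewrite -(@ge0_integral_pushforward _ _ _ _ _ _ mC pi setT (EFin \o f))//.
- apply: eq_measure_integral => A mA _; exact: pimu.
- exact/measurable_EFinP.
- by move=> t _; rewrite lee_fin.
Qed.

(** Integrates [min = gap - (shortfall - s)]. The subtracted term is the same for all couplings, so
    minimizing the cost amounts to minimizing the integral of the gap. *)
Lemma integral_min_cost (pi : probability (borelRn R n) R) : coupling mu pi ->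
  (\int[pi]_x min_cost x =
   \int[pi]_x (gap x)%:E - (\sum_(i < n) I i - s%:E))%E.
Proof.
move=> pimu.
pose f i x := Num.max (s - coordinate i x) 0.
have mf i : measurable_fun setT (f i).
  apply: measurable_maxr => //.
  by apply: measurable_funB => //; exact: measurable_coordinate.
have f_ge0 i x : 0 <= f i x by rewrite le_max lexx orbT.
have fE i : (\int[pi]_x (f i x)%:E = I i)%E.
  apply: (integral_coordinate pi i (fun t => Num.max (s - t) 0)) => //.
    by apply: measurable_maxr => //; exact: measurable_funB.
  by move=> t; rewrite le_max lexx orbT.
have intf i : pi.-integrable setT (EFin \o f i).
  apply/integrableP; split; first exact/measurable_EFinP.
  under eq_integral => x _ do rewrite /= ger0_norm//.
  by rewrite fE.
have ints : pi.-integrable setT (EFin \o cst s).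
  exact: finite_measure_integrable_cst.
have shortE : EFin \o (fun x => shortfall x) = fun x => \sum_(i < n) (f i x)%:E.
  by apply/funext => x; rewrite /= /shortfall -sumEFin.
have intS : pi.-integrable setT (EFin \o (fun x => shortfall x)).
  by rewrite shortE; apply: integrable_sum => // i _; exact: intf.
transitivity (\int[pi]_x (gap x - (shortfall x - s))%:E)%E.
  apply: eq_integral => x _; have [i [ci _]] := min_costP x.
  by rewrite /gap ci /=; congr (_%:E); ring.
rewrite integralB_ge0//.
- congr (_ - _)%E; rewrite integralB_EFin//; congr (_ - _)%E.
    rewrite -[LHS]/(\int[pi]_x (EFin \o (fun x => shortfall x)) x)%E shortE.
    rewrite ge0_integral_sum//.
    + by apply: eq_bigr => i _; exact: fE.
    + by move=> i; exact/measurable_EFinP.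
    + by move=> i x _; rewrite lee_fin.
  exact: integral_cst_probability.
- exact: measurable_gap.
- exact: gap_ge0.
- exact: (integrableB _ intS ints).
Qed.

(** Finiteness allows this constant to be cancelled when two costs are compared. *)
Lemma sum_shortfall_fin_num : (\sum_(i < n) I i - s%:E)%E \is a fin_num.
Proof.
rewrite fin_numB andbT; apply/sum_fin_numP => i _ _.
rewrite ge0_fin_numE// integral_ge0// => t _.
by rewrite lee_fin le_max lexx orbT.
Qed.

End gap.

(* The premises of 1) and 2) are strict: with weak premises the "only if"
   direction fails. For n = 2 and both marginals uniform on [0, 1], s = 1/2
   and the equal mixture of the uniform measures on [0, 1/2] x [1/2, 1] and
   [1/2, 1] x [0, 1/2] is optimal, but (0, 1/2) is in its support. *)
Theorem theorem2p17 (R : realType) (n : nat) (hn : (2 <= n)%N)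
    (mu : 'I_n -> probability (measurableTypeR R) R)
    (hatomless : forall i : 'I_n, atomless (mu i))
    (hneg : forall i : 'I_n, integrable_neg_part (mu i))
    (pi : probability (borelRn R n) R) (hpi : coupling mu pi) :
  solves_MK mu (@min_cost R n) pi <->
  (forall x : 'rV[R]_n, measure_supp pi x -> forall i : 'I_n,
     (x ord0 i < threshold mu ->
        forall j : 'I_n, j != i -> threshold mu <= x ord0 j) /\
     (threshold mu < x ord0 i ->
        exists j : 'I_n, j != i /\ x ord0 j <= threshold mu)).
Proof.
have n0 : (0 < n)%N by exact: ltnW.
pose s := threshold mu.
have costE nu (hnu : coupling mu nu) := integral_min_cost s n0 mu hneg nu hnu.
have fin := sum_shortfall_fin_num s mu hneg.
(* Nullity of [misplaced s] links the two sides: it is the support condition by openness, and zero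
   integral of the gap by [integral_gap_eq0]. *)
transitivity (pi (misplaced s) = 0%E); last first.
  rewrite (measure_supp_disjoint _ _ _ _ (open_misplaced _ _ s)).
  by split=> supp x /supp /(not_misplacedP _ _ _ _ n0).
rewrite -(integral_gap_eq0 s n0); split=> [[_ opt]|gap0].
  (* Optimality is tested against the zero-gap coupling [nu], which forces the integral of the gap
     under [pi] to be at most 0. *)
  have [nu hnu nu0] :=
    exists_coupling_misplaced0 mu s
      (sum_distr_fun_threshold _ _ _ hn hatomless).
  apply/eqP; rewrite eq_le integral_ge0 ?andbT; last first.
    by move=> x _; rewrite lee_fin gap_ge0.
  move/(integral_gap_eq0 s n0): nu0 => <-.
  by have := opt nu hnu; rewrite !costE// leeD2rE ?fin_numN.
split=> // nu hnu; rewrite !costE// leeD2rE ?fin_numN// gap0.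
by apply: integral_ge0 => x _; rewrite lee_fin gap_ge0.
Qed.
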